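(* Let $G$ be a group with identity $e$, let $R$ be a $G$-graded commutative ring with nonzero unity, let $M$ be a $G$-graded unitary $R$-module, and let $\phi: GS(M)\rightarrow GS(M)\cup\{\emptyset\}$ be a function with $\phi(L)\subseteq L$ for all $L\in GS(M)$. Let $g\in G$ and let $K$ be a graded $R$-submodule of $M$ such that $K_g\neq M_g$. Then the following statements are equivalent: (1) $K$ is a $g$-$\phi$-prime $R$-submodule of $M$. (2) For every $m\in M_g-K$, $(K:_{R_e}m)=(K:_{R_e}M)\cup(\phi(K):_{R_e}m)$. (3) For every $m\in M_g-K$, $(K:_{R_e}m)=(K:_{R_e}M)$ or $(K:_{R_e}m)=(\phi(K):_{R_e}m)$. (4) For any ideal $I$ of $R_e$ and any graded $R$-submodule $N$ of $M$, if $IN_g\subseteq K$ and $IN_g\nsubseteq\phi(K)$, then $I\subseteq(K:_RM)$ or $N_g\subseteq K$.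
   Context: $G$ is a group with identity $e$. $R=\bigoplus_{h\in G}R_h$ is a $G$-graded commutative ring with nonzero unity $1$ ($R_h$ additive subgroups, $R_hR_k\subseteq R_{hk}$), and $M=\bigoplus_{h\in G}M_h$ is a $G$-graded unitary $R$-module ($M_h$ additive subgroups, $R_hM_k\subseteq M_{hk}$). An $R$-submodule $K$ of $M$ is graded if $K=\bigoplus_{h\in G}(K\cap M_h)$; write $K_h=K\cap M_h$ (and $N_h=N\cap M_h$). $GS(M)$ is the set of all graded $R$-submodules of $M$. Notation: $(K:_RM)=\{r\in R: rM\subseteq K\}$, $(K:_{R_e}M)=\{r\in R_e: rM\subseteq K\}$, and for $m\in M$ and a subset $X$ of $M$, $(X:_{R_e}m)=\{r\in R_e: rm\in X\}$ (which is empty if $X=\emptyset$). $IN_g$ denotes the additive subgroup generated by the products $rn$ with $r\in I$, $n\in N_g$. The symbol $-$ between sets denotes set difference. For $g\in G$ and a graded $R$-submodule $K$ of $M$ with $K_g\neq M_g$, $K$ is a $g$-$\phi$-prime $R$-submodule of $M$ if whenever $r\in R_e$ and $m\in M_g$ satisfy $rm\in K-\phi(K)$, then $m\in K$ or $r\in(K:_RM)$. *)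

(* Defs.v *)
From HB Require Import structures.
From mathcomp Require Import all_boot all_order all_algebra.
From mathcomp Require Import all_classical.

Set Implicit Arguments.
Unset Strict Implicit.
Unset Printing Implicit Defensive.

Import GRing.Theory.
Local Open Scope classical_set_scope.
Local Open Scope ring_scope.

Section DirectSum.
Variables (G : choiceType) (V : zmodType).

(* [x] has finite support, so the [\sum_(h \in setT)] below is the true sum:
   on infinite supports that notation defaults to 0. *)
Definition decomposes (V_ : G -> set V) (v : V) (x : G -> V) : Prop :=
  [/\ forall h, V_ h (x h),
      finite_set [set h | x h != 0]
    & v = \sum_(h \in [set: G]) x h].

(* [A] is the internal direct sum of the additive subgroups [V_ h]. *)
Definition internal_direct_sum (V_ : G -> set V) (A : set V) : Prop :=
  [/\ forall h, zmod_closed [in V_ h],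
      A = [set v | exists x, decomposes V_ v x]
    & forall v x y, decomposes V_ v x -> decomposes V_ v y -> x = y].

End DirectSum.

Section Graded.
Variables (G : groupType) (R : comNzRingType) (M : lmodType R).

Definition graded_ring (R_ : G -> set R) : Prop :=
  internal_direct_sum R_ [set: R] /\
  forall (h k : G) (r s : R), R_ h r -> R_ k s -> R_ (h * k)%g (r * s).

Definition graded_module (R_ : G -> set R) (M_ : G -> set M) : Prop :=
  internal_direct_sum M_ [set: M] /\
  forall (h k : G) (r : R) (m : M), R_ h r -> M_ k m -> M_ (h * k)%g (r *: m).

Definition graded_submodule (M_ : G -> set M) (K : set M) : Prop :=
  submod_closed [in K] /\ internal_direct_sum (fun h => K `&` M_ h) K.

Definition GS (M_ : G -> set M) : set (set M) := graded_submodule M_.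

(* (K :_R M) *)
Definition colon_module (K : set M) : set R :=
  [set r | forall m : M, K (r *: m)].

(* (X :_R m); intersected with [R_ 1%g] it gives (X :_{R_e} m). *)
Definition colon_elt (X : set M) (m : M) : set R := [set r | X (r *: m)].

(* [K `&` M_ g <> M_ g] is the condition under which the notion is defined. *)
Definition g_phi_prime (R_ : G -> set R) (M_ : G -> set M)
    (phi : set M -> set M) (g : G) (K : set M) : Prop :=
  [/\ graded_submodule M_ K,
      K `&` M_ g <> M_ g
    & forall (r : R) (m : M), R_ 1%g r -> M_ g m ->
        (K `\` phi K) (r *: m) -> K m \/ colon_module K r].

(* Ideals of a subring [S] of [R], as subsets of [R]. *)
Definition ideal_of (S I : set R) : Prop :=
  [/\ I `<=` S, zmod_closed [in I]
    & forall r a : R, S r -> I a -> I (r * a)].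

(* The additive subgroup of [M] generated by the products [r *: n]. *)
Definition prod_subgroup (I : set R) (X : set M) : set M :=
  smallest (fun A : set M => zmod_closed [in A])
           [set r *: n | r in I & n in X].

End Graded.

(* Main.v *)
Require Import Defs.
From HB Require Import structures.
From mathcomp Require Import all_boot all_order all_algebra.
From mathcomp Require Import finmap.
From mathcomp Require Import all_classical.

Set Implicit Arguments.
Unset Strict Implicit.
Unset Printing Implicit Defensive.

Import GRing.Theory.
Local Open Scope classical_set_scope.
Local Open Scope ring_scope.

(** The equivalence is proved as the cycle (1) => (2) => (3) => (4) => (1),
    for a set [P] inside [K] that, like [phi K], is empty or a graded
    submodule.

    (1) => (2) is elementwise.  For (2) => (3), the colons in question are
    additive groups, and a group covered by two subgroups equals one of them
    ([zmod_closed_setU]); if [phi K] is empty, its colon is empty and the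
    first alternative holds.

    For (3) => (4), pick [n0] in [N_g] outside [K], and suppose [I] is not
    contained in [(K : M)].  Every [n] in [N_g] outside [K] falls under the
    second alternative of (3), so [I n] lies in [phi K]; an [n] inside [K] is
    the difference of [n + n0] and [n0], both outside [K].  Hence [I N_g] lies
    in [phi K] ([prod_subgroup_dichotomy]).  That [phi K] is not empty, hence
    a submodule, follows from [I n0] lying in it.

    For (4) => (1), given [r m] in [K - phi K], the natural pair would be
    the principal ideal [R_e r] and the cyclic module [R m].  Larger ones are
    easier to handle: [I = (K :_{R_e} m)] and [N = {n | I n <= K}].
    They contain [r] and [m], and [I N <= K] by construction; [N] is graded
    because multiplying by degree [e] elements preserves homogeneous
    components ([graded_annihilator_mod]).  Statement (4) for this pair then
    says that [r] multiplies [M] into [K] or that [m] lies in [K]. *)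

(** * Additive subgroups and submodules as sets *)

Section ClosedSets.
Variable V : zmodType.

Lemma zmod_closed_setP (A : set V) :
  zmod_closed [in A] <-> A 0 /\ (forall x y, A x -> A y -> A (x - y)).
Proof.
split=> [[A0 AB]|[A0 AB]]; split.
- exact: set_mem A0.
- by move=> x y Ax Ay; apply: set_mem; apply: AB; apply: mem_set.
- exact: mem_set.
- by move=> x y /set_mem Ax /set_mem Ay; apply: mem_set; apply: AB.
Qed.

Lemma zmod_closed_setD (A : set V) :
  zmod_closed [in A] -> forall x y, A x -> A y -> A (x + y).
Proof.
move=> /zmod_closed_setP[A0 AB] x y Ax Ay.
by rewrite -[y]opprK; apply: (AB) => //; rewrite -sub0r; apply: AB.
Qed.

Lemma zmod_closed_setI (A B : set V) :
  zmod_closed [in A] -> zmod_closed [in B] -> zmod_closed [in A `&` B].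
Proof.
move=> /zmod_closed_setP[A0 AB] /zmod_closed_setP[B0 BB].
apply/zmod_closed_setP; split=> // x y [Ax Bx] [Ay By].
by split; [apply: AB | apply: BB].
Qed.

Lemma zmod_closed_fsum (I : choiceType) (A : set V) (x : I -> V) :
  zmod_closed [in A] -> (forall i, A (x i)) -> A (\sum_(i \in [set: I]) x i).
Proof.
move=> Ac Ax; have /zmod_closed_setP[A0 _] := Ac.
by elim/big_ind: _ => // u v; apply: zmod_closed_setD.
Qed.

(** If neither part contained the other, the sum of an element of [A - B]
    and an element of [B - A] could lie in neither. *)
Lemma zmod_closed_setU (C A B : set V) : zmod_closed [in C] ->
  zmod_closed [in A] -> zmod_closed [in B] -> C = A `|` B -> C = A \/ C = B.
Proof.
move=> Cc Ac Bc CE.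
have /zmod_closed_setP[_ AB] := Ac; have /zmod_closed_setP[_ BB] := Bc.
have [/setUidPr AsubB|/existsNP[a /not_implyP[Aa nBa]]] := pselect (A `<=` B).
  by right; rewrite CE.
left; rewrite CE; apply/setUidPl => b Bb.
have : C (a + b) by apply: (zmod_closed_setD Cc); rewrite CE; [left|right].
rewrite CE => -[Aab|Bab].
  by rewrite -[b](addKr a) addrC; apply: AB.
by case: nBa; rewrite -[a](addrK b); apply: BB.
Qed.

End ClosedSets.

Section Modules.
Variables (R : comNzRingType) (M : lmodType R).

Lemma submod_closed_setP (K : set M) : submod_closed [in K] ->
  zmod_closed [in K] /\ (forall (r : R) m, K m -> K (r *: m)).
Proof.
move=> [K0 KD]; have Kr r m : K m -> K (r *: m).
  move=> Km; apply: set_mem; rewrite -[_ *: _]addr0.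
  by apply: KD => //; apply: mem_set.
split=> //; apply/zmod_closed_setP; split; first exact: set_mem K0.
move=> x y Kx Ky; apply: set_mem; rewrite addrC -scaleN1r.
by apply: KD; apply: mem_set.
Qed.

Lemma zmod_closed_colon_module (K : set M) :
  submod_closed [in K] -> zmod_closed [in colon_module K].
Proof.
move=> /submod_closed_setP[/zmod_closed_setP[K0 KB] _].
apply/zmod_closed_setP; split=> [m|r s Kr Ks m]; first by rewrite scale0r.
by rewrite scalerBl; apply: KB.
Qed.

Lemma zmod_closed_colon_elt (K : set M) m :
  submod_closed [in K] -> zmod_closed [in colon_elt K m].
Proof.
move=> /submod_closed_setP[/zmod_closed_setP[K0 KB] _].
apply/zmod_closed_setP; rewrite /colon_elt /=; split=> [|r s Kr Ks].
  by rewrite scale0r.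
by rewrite scalerBl; apply: KB.
Qed.

End Modules.

(** * Homogeneous components and graded submodules *)

Section GradedModules.
Variables (G : groupType) (R : comNzRingType) (M : lmodType R).
Variables (R_ : G -> set R) (M_ : G -> set M).
Hypotheses (gradR : graded_ring R_) (gradM : graded_module R_ M_).

Lemma graded_ring_zmod_closed h : zmod_closed [in R_ h].
Proof. by case: gradR => -[]. Qed.

Lemma graded_module_zmod_closed h : zmod_closed [in M_ h].
Proof. by case: gradM => -[]. Qed.

Lemma graded_ring_1M r s : R_ 1%g r -> R_ 1%g s -> R_ 1%g (r * s).
Proof. by case: gradR => _ RM Rr Rs; rewrite -[1%g]mulg1; apply: RM. Qed.

(** A scalar of degree [e] keeps each component in its degree, so the scaled
    family is again a decomposition. *)
Lemma decomposes_scale (a : R) (m : M) (x : G -> M) : R_ 1%g a ->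
  decomposes M_ m x -> decomposes M_ (a *: m) (fun h => a *: x h).
Proof.
case: gradM => _ MS Ra [Mx fx ->].
have fin_ax : finite_set [set h | a *: x h != 0].
  apply: sub_finite_set fx => h /=; apply: contra_neq => ->.
  by rewrite scaler0.
split=> // [h|]; first by have := MS 1%g h _ _ Ra (Mx h); rewrite mul1g.
have supp_out h : h \notin fset_set [set h | x h != 0] -> x h = 0.
  rewrite in_fset_set // => xh; apply/eqP; apply: contraNT xh => xh0.
  exact: mem_set.
(* The support may shrink under [a]; both sums are taken over that of [x]. *)
rewrite !(fsbigTE (fset_set [set h | x h != 0])) ?scaler_sumr //.
by move=> h /supp_out ->; rewrite scaler0.
Qed.

(** A submodule is graded as soon as it contains the homogeneous components
    of its elements: uniqueness is inherited from the ambient module. *)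
Lemma graded_submodule_components (N : set M) : submod_closed [in N] ->
  (forall n x, N n -> decomposes M_ n x -> forall h, N (x h)) ->
  graded_submodule M_ N.
Proof.
case: gradM => -[Mc Mtot Muniq] _ Nc Ncomp.
have [Nz _] := submod_closed_setP Nc.
split=> //; split.
- by move=> h; apply: zmod_closed_setI.
- apply/seteqP; split=> [n Nn|_ [x [Nx _ ->]]].
    have : [set: M] n by [].
    rewrite Mtot => -[x xn]; have [Mx fx nE] := xn.
    by exists x; split=> // h; split=> //; apply: Ncomp xn h.
  by apply: zmod_closed_fsum => // h; case: (Nx h).
- move=> v x y [Nx fx vx] [Ny fy vy].
  apply: (Muniq v); split=> // h; first by case: (Nx h).
  by case: (Ny h).
Qed.

Lemma graded_submodule_component (K : set M) (m : M) (x : G -> M) :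
  graded_submodule M_ K -> K m -> decomposes M_ m x -> forall h, K (x h).
Proof.
case: gradM => -[_ _ Muniq] _ [_ [_ KE _]] + xm h; rewrite {1}KE.
move=> -[y [Ky fy my]].
have <- : y = x by apply: Muniq xm; split=> // k; case: (Ky k).
by case: (Ky h).
Qed.

(** This is the annihilator of [I] modulo [K]: if [a n] lies in [K], so do
    its components, which are [a] times those of [n] when [a] has degree
    [e]. *)
Lemma graded_annihilator_mod (I : set R) (K : set M) :
  I `<=` R_ 1%g -> graded_submodule M_ K ->
  graded_submodule M_ [set n | forall a, I a -> K (a *: n)].
Proof.
move=> IR gradK.
have [Kz KS] := submod_closed_setP gradK.1.
have /zmod_closed_setP[K0 _] := Kz.
apply: graded_submodule_components => [|n x Nn xn h a Ia].
  split=> [|r u v /set_mem Nu /set_mem Nv]; apply: mem_set => a Ia.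
    by rewrite scaler0.
  rewrite scalerDr scalerA mulrC -scalerA.
  by apply: zmod_closed_setD => //; [apply/KS/Nu | apply: Nv].
apply: (graded_submodule_component gradK (Nn a Ia) (x := fun k => a *: x k)).
exact: decomposes_scale (IR a Ia) xn.
Qed.

Lemma ideal_of_colon_elt (K : set M) (m : M) : submod_closed [in K] ->
  ideal_of (R_ 1%g) (R_ 1%g `&` colon_elt K m).
Proof.
move=> Kc; have [_ KS] := submod_closed_setP Kc.
split=> [r []//||r a Rr [Ra Ka]].
  apply: zmod_closed_setI (graded_ring_zmod_closed _) _.
  exact: zmod_closed_colon_elt.
split; first exact: graded_ring_1M.
by rewrite /colon_elt /= -scalerA; apply: KS.
Qed.

(** * Colon conditions in a fixed degree *)

Section ColonConditions.
(* [P] plays the role of [phi K]. *)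
Variables (g : G) (K P : set M).
Hypotheses (gradK : graded_submodule M_ K) (subP : P `<=` K).
Hypothesis (PE : GS M_ P \/ P = set0).

Lemma colon_eltU (prime : forall r m, R_ 1%g r -> M_ g m ->
    (K `\` P) (r *: m) -> K m \/ colon_module K r) m :
  (M_ g `\` K) m -> R_ 1%g `&` colon_elt K m =
    (R_ 1%g `&` colon_module K) `|` (R_ 1%g `&` colon_elt P m).
Proof.
move=> [Mm nKm]; apply/seteqP; split=> [r [Rr Krm]|r].
  have [Prm|nPrm] := pselect (P (r *: m)); first by right.
  by left; split=> //; case: (prime r m Rr Mm).
by move=> -[] [Rr rP]; split=> //; apply: subP.
Qed.

Lemma colon_elt_dichotomy m :
  R_ 1%g `&` colon_elt K m =
    (R_ 1%g `&` colon_module K) `|` (R_ 1%g `&` colon_elt P m) ->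
  R_ 1%g `&` colon_elt K m = R_ 1%g `&` colon_module K \/
  R_ 1%g `&` colon_elt K m = R_ 1%g `&` colon_elt P m.
Proof.
have Rc := graded_ring_zmod_closed 1%g.
case: PE => [[Pc _]|->] KE.
  apply: zmod_closed_setU KE; apply: zmod_closed_setI => //.
  - exact: zmod_closed_colon_elt gradK.1.
  - exact: zmod_closed_colon_module gradK.1.
  - exact: zmod_closed_colon_elt.
by left; rewrite KE; apply/setUidPl => r [].
Qed.

(** The choice between the two alternatives may vary with [m], but an [I]
    outside [(K : M)] excludes the first one for all [m] at once; the
    elements of [N_g] outside [K] then control those inside by translation. *)
Lemma prod_subgroup_dichotomy (dich : forall m, (M_ g `\` K) m ->
    R_ 1%g `&` colon_elt K m = R_ 1%g `&` colon_module K \/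
    R_ 1%g `&` colon_elt K m = R_ 1%g `&` colon_elt P m)
    (I : set R) (N : set M) : ideal_of (R_ 1%g) I -> zmod_closed [in N] ->
  prod_subgroup I (N `&` M_ g) `<=` K ->
  ~ (prod_subgroup I (N `&` M_ g) `<=` P) ->
  I `<=` colon_module K \/ N `&` M_ g `<=` K.
Proof.
move=> [IR /zmod_closed_setP[I0 _] _] Nc INK nINP.
have Ngc := zmod_closed_setI Nc (graded_module_zmod_closed g).
have [Kz _] := submod_closed_setP gradK.1.
have /zmod_closed_setP[_ KB] := Kz.
have [|nIK] := pselect (I `<=` colon_module K); first by left.
right; apply: contrapT => /existsNP[n0 /not_implyP[Nn0 nKn0]]; apply: nINP.
have IK a n : I a -> (N `&` M_ g) n -> K (a *: n).
  by move=> Ia Nn; apply: INK => A [_]; apply; exists a => //; exists n.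
have out a n : I a -> (N `&` M_ g) n -> ~ K n -> P (a *: n).
  move=> Ia Nn nKn; have sub b : I b -> (R_ 1%g `&` colon_elt K n) b.
    by move=> Ib; split; [apply: IR | apply: IK].
  case: (dich n (conj Nn.2 nKn)) => E.
    by case: nIK => b /sub; rewrite E => -[].
  by have := sub a Ia; rewrite E => -[].
(* If [P] were empty, it could not contain [0 *: n0]. *)
have Pz : zmod_closed [in P].
  case: PE => [[/submod_closed_setP[]]//|P0].
  by have := out 0 n0 I0 Nn0 nKn0; rewrite P0.
have /zmod_closed_setP[_ PB] := Pz.
apply: smallest_sub => // _ [a Ia [n Nn <-]].
have [Kn|] := pselect (K n); last exact: out.
(* Translating by [n0] moves [n] out of [K]. *)
rewrite -[n](addrK n0) scalerBr; apply: PB; apply: out => //.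
  exact: (zmod_closed_setD Ngc).
by move=> Knn0; apply: nKn0; rewrite -[n0](addKr n) addrC; apply: KB.
Qed.

(** The ideal [I] below is the whole of [(K :_{R_e} m)] and [N] everything
    that [I] multiplies into [K], so that [I N_g <= K] needs no description of
    the elements of the principal ideal [R_e r] or of the degree [g] part of
    [R m]. *)
Lemma prime_of_prod_subgroup (prod : forall (I : set R) (N : set M),
    ideal_of (R_ 1%g) I -> GS M_ N ->
    prod_subgroup I (N `&` M_ g) `<=` K ->
    ~ (prod_subgroup I (N `&` M_ g) `<=` P) ->
    I `<=` colon_module K \/ N `&` M_ g `<=` K) r m :
  R_ 1%g r -> M_ g m -> (K `\` P) (r *: m) -> K m \/ colon_module K r.
Proof.
move=> Rr Mm [Krm nPrm].
pose I := R_ 1%g `&` colon_elt K m.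
pose N := [set n | forall a, I a -> K (a *: n)].
have [Kz _] := submod_closed_setP gradK.1.
have Ir : I r by [].
have Nm : (N `&` M_ g) m by split=> // a [].
have Iid : ideal_of (R_ 1%g) I by exact: ideal_of_colon_elt gradK.1.
have Ngr : GS M_ N by apply: graded_annihilator_mod => // a [].
have INK : prod_subgroup I (N `&` M_ g) `<=` K.
  by apply: smallest_sub => // _ [a Ia [n [Nn _] <-]]; apply: Nn.
have nINP : ~ (prod_subgroup I (N `&` M_ g) `<=` P).
  move=> INP; apply/nPrm/INP => A [_]; apply.
  by exists r => //; exists m.
case: (prod I N Iid Ngr INK nINP) => [IK|NK]; first by right; apply: IK.
by left; apply: NK.
Qed.

End ColonConditions.

End GradedModules.

Theorem theorem2p9 (G : groupType) (R : comNzRingType) (M : lmodType R)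
    (R_ : G -> set R) (M_ : G -> set M)
    (gradR : graded_ring R_) (gradM : graded_module R_ M_)
    (phi : {fun GS M_ >-> GS M_ `|` [set set0]})
    (phi_sub : forall L : set M, GS M_ L -> phi L `<=` L)
    (g : G) (K : set M) (gradK : GS M_ K) (K_g_neq : K `&` M_ g <> M_ g) :
  let Re := R_ 1%g in
  [<-> (* (1) *)
       g_phi_prime R_ M_ phi g K;
       (* (2) *)
       forall m : M, (M_ g `\` K) m ->
         Re `&` colon_elt K m =
           (Re `&` colon_module K) `|` (Re `&` colon_elt (phi K) m);
       (* (3) *)
       forall m : M, (M_ g `\` K) m ->
         Re `&` colon_elt K m = Re `&` colon_module K \/
         Re `&` colon_elt K m = Re `&` colon_elt (phi K) m;
       (* (4) *)
       forall (I : set R) (N : set M), ideal_of Re I -> GS M_ N ->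
         prod_subgroup I (N `&` M_ g) `<=` K ->
         ~ (prod_subgroup I (N `&` M_ g) `<=` phi K) ->
         I `<=` colon_module K \/ N `&` M_ g `<=` K].
Proof.
have subP := phi_sub K gradK.
have PE : GS M_ (phi K) \/ phi K = set0 by exact: (@funS _ _ _ _ phi K gradK).
move=> Re; tfae.
- by move=> [_ _ prime] m; apply: colon_eltU.
- by move=> KE m /KE; apply: (colon_elt_dichotomy gradR gradK PE).
- move=> dich I N Iid [Nc _].
  have [Nz _] := submod_closed_setP Nc.
  exact: (prod_subgroup_dichotomy gradM gradK PE dich Iid Nz).
- move=> prod; split=> // r m.
  exact: (prime_of_prod_subgroup gradR gradM gradK prod).
Qed.
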